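(* Let $H$ be a complex Hilbert space and let $(x_i)_{i\in I}$ be a frame for $H$, with $I$ a countable index set. Then there exist a scalar $a$ and two normalized tight frames $(y_i)_{i\in I}$ and $(z_i)_{i\in I}$ for $H$ such that $x_i=a(y_i+z_i)$ for all $i\in I$.
   Context: A family $(x_i)_{i\in I}$ in a Hilbert space $H$ is a frame for $H$ if there are constants $0<A\le B$ such that $A\|x\|^2\le\sum_{i\in I}|\langle x,x_i\rangle|^2\le B\|x\|^2$ for all $x\in H$. It is a normalized tight frame for $H$ if this holds with $A=B=1$, i.e. $\sum_{i\in I}|\langle x,x_i\rangle|^2=\|x\|^2$ for all $x\in H$. *)

(* Defs.v *)
From mathcomp Require Import all_boot all_order all_algebra.
From mathcomp Require Import all_classical all_reals all_analysis.
From mathcomp Require Import complex.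
Set Implicit Arguments.
Unset Strict Implicit.
Unset Printing Implicit Defensive.
Import Order.TTheory GRing.Theory Num.Theory Num.Def.
Import numFieldNormedType.Exports.

Local Open Scope classical_set_scope.
Local Open Scope ring_scope.
Local Open Scope complex_scope.

(* Norms over R[i] take their values in R[i]; the squared norm is brought back
   to R so that it can be summed in \bar R. With V := R[i] this is the squared
   modulus of a scalar. *)
Definition sqnorm (R : realType) (V : normedZmodType R[i]) (v : V) : R :=
  complex.Re (`|v| ^+ 2).

(* The inner product of a complex Hilbert space: a positive definite Hermitian
   form, linear in its first argument, inducing the norm for which the space is
   complete. *)
Definition hilbert_dot (R : realType) (H : completeNormedModType R[i])
    (dot : {dot H for conjC}) : Prop :=
  forall v : H, `|v| ^+ 2 = dot v v.

Section frames.
Context (R : realType) (H : completeNormedModType R[i]).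
Context (dot : {dot H for conjC}) (I : choiceType).

Definition is_frame (x_ : I -> H) : Prop :=
  exists A B : R, [/\ 0 < A, A <= B & forall v : H,
    ((A * sqnorm v)%:E <= \esum_(i in [set: I]) (sqnorm (dot v (x_ i)))%:E
                       <= (B * sqnorm v)%:E)%E].

Definition is_normalized_tight_frame (x_ : I -> H) : Prop :=
  forall v : H,
    \esum_(i in [set: I]) (sqnorm (dot v (x_ i)))%:E = (sqnorm v)%:E.

End frames.

(* Main.v *)
Require Import Defs.
From mathcomp Require Import all_boot all_order all_algebra.
From mathcomp Require Import all_classical all_reals all_analysis.
From mathcomp Require Import complex.
From mathcomp Require Import ring lra.
Set Implicit Arguments.
Unset Strict Implicit.
Unset Printing Implicit Defensive.
Import Order.TTheory GRing.Theory Num.Theory Num.Def.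
Import numFieldNormedType.Exports.
Local Open Scope ring_scope.
Local Open Scope complex_scope.

(** Let S be the frame operator, S v = sum_i <v, x_i> x_i, so that the frame
    inequalities read A <= S <= B. For a bounded map V, the family V x_i
    satisfies sum_i |<v, V x_i>|^2 = <V S V^* v, v>, hence it is a normalized
    tight frame as soon as V S V^* = 1. The usual choice V = S^(-1/2) may be
    composed with any unitary map, and the positive contraction
    S^(1/2) / |S^(1/2)| is the mean P of the two unitaries P + i sqrt(1 - P^2)
    and P - i sqrt(1 - P^2).

    Composing these two steps, and replacing the norm by a more convenient
    constant, one looks for a self-adjoint K commuting with S and a real c > 0
    such that V = c (1 + i K) and W = c (1 - i K) both work. Their sum is the
    scalar 2 c, so x_i = (2 c)^-1 (V x_i + W x_i), and
    V S V^* = W S W^* = c^2 (1 + K^2) S; the condition is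
    (1 + K^2) S = c^-2. Writing S = t (1 - X) with t = A + B, the spectrum of X
    lies in [A / t, B / t] and K = sqrt((1 + X) / (1 - X)) gives
    (1 + K^2) S = 2 t, so c = (2 t)^(-1/2).

    Three constructions carry this out. [frame_operator] produces S as a
    strongly convergent series; [numerical_radius_bound] turns the bounds on the
    quadratic form of X into the norm bound |X| <= q < 1; and [sqrt_cayley]
    produces K from a square root and an inverse, both limits of geometrically
    convergent iterations ([one_minus_sqrt], [neumann_inverse]). *)

(** * Real-valued norms *)

(** A norm over R[i] takes values in R[i], which is only partially ordered; its
    values are nonnegative reals, and estimates are carried out on these. *)
Definition rnorm (R : realType) (V : normedZmodType R[i]) (v : V) : R :=
  complex.Re `|v|.

Section real_norm.
Context (R : realType) (V : normedZmodType R[i]).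
Implicit Types u v : V.

Lemma normr_rnorm v : `|v| = (rnorm v)%:C.
Proof. by rewrite /rnorm RRe_real ?normr_real. Qed.

Lemma rnorm_ge0 v : 0 <= rnorm v.
Proof. by rewrite -ler0c -normr_rnorm. Qed.

Lemma sqnormE v : sqnorm v = rnorm v ^+ 2.
Proof. by rewrite /sqnorm normr_rnorm -rmorphXn. Qed.

Lemma rnorm0 : rnorm (0 : V) = 0.
Proof. by apply: complexI; rewrite -normr_rnorm normr0. Qed.

Lemma rnorm0_eq0 v : rnorm v = 0 -> v = 0.
Proof. by move=> v0; apply: normr0_eq0; rewrite normr_rnorm v0. Qed.

Lemma rnormN v : rnorm (- v) = rnorm v.
Proof. by rewrite /rnorm normrN. Qed.

Lemma rnormB u v : rnorm (u - v) = rnorm (v - u).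
Proof. by rewrite -rnormN opprB. Qed.

Lemma ler_rnormD u v : rnorm (u + v) <= rnorm u + rnorm v.
Proof. by rewrite -lecR rmorphD /= -!normr_rnorm ler_normD. Qed.

End real_norm.

Lemma rnormZ (R : realType) (V : normedModType R[i]) (a : R[i]) (v : V) :
  rnorm (a *: v) = rnorm a * rnorm v.
Proof. by apply: complexI; rewrite rmorphM /= -!normr_rnorm normrZ. Qed.

Lemma rnormM (R : realType) (a b : R[i]) : rnorm (a * b) = rnorm a * rnorm b.
Proof. by apply: complexI; rewrite rmorphM /= -!normr_rnorm normrM. Qed.

Lemma rnorm_real (R : realType) (a : R) : rnorm (a%:C) = `|a|.
Proof. by apply: complexI; rewrite -normr_rnorm normc_def /= expr0n addr0 sqrtr_sqr. Qed.

Lemma rnorm_conj (R : realType) (a : R[i]) : rnorm (conjC a) = rnorm a.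
Proof. by rewrite /rnorm norm_conjC. Qed.

Lemma conj_real (R : realType) (a : R) : conjC (a%:C) = a%:C.
Proof. by apply: conj_Creal; apply/complex_realP; exists a. Qed.

Lemma gt0_complexE (R : realType) (e : R[i]) :
  0 < e -> 0 < complex.Re e /\ e = (complex.Re e)%:C.
Proof. by case: e => a b; rewrite ltcE /= => /andP[/eqP -> ?]. Qed.

(** * Convergence in a normed space over the complex numbers *)

Section convergence.
Local Open Scope classical_set_scope.

(** Reduces limits in the space to limits of real sequences, where squeezing
    and linear arithmetic apply. *)
Lemma cvg_rnorm (R : realType) (V : normedModType R[i]) (u : nat -> V) (l : V) :
  rnorm (u n - l) @[n --> \oo] --> (0 : R) <-> u @ \oo --> l.
Proof.
split=> [|] /cvgrPdist_lt ul; apply/cvgrPdist_lt => e e0.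
- have [a0 eE] := gt0_complexE e0.
  near=> n; rewrite eE normr_rnorm ltcR rnormB.
  have : `|0 - rnorm (u n - l)| < complex.Re e by near: n; exact: ul.
  by rewrite sub0r normrN ger0_norm ?rnorm_ge0.
- near=> n; rewrite sub0r normrN ger0_norm ?rnorm_ge0// rnormB -ltcR -normr_rnorm.
  by near: n; apply: ul; rewrite ltcR.
Unshelve. all: by end_near. Qed.

Lemma rnorm_dominated_cvg (R : realType) (H : completeNormedModType R[i])
    (u : nat -> H) (d : nat -> R) :
    d @ \oo --> (0 : R) ->
    (forall m k, rnorm (u (m + k)%N - u m) <= d m) ->
  exists l : H, u @ \oo --> l.
Proof.
move=> /cvgrPdist_lt d0 ud; exists (lim (u @ \oo)).
apply/cauchy_cvgP; apply: cauchy_exP => e e0.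
have [a0 eE] := gt0_complexE e0.
have [N _ dN] := d0 _ a0; exists (u N).
exists N => // n /= Nn; rewrite -ball_normE /= eE normr_rnorm ltcR rnormB.
rewrite -(subnKC Nn); apply: le_lt_trans (ud _ _) _.
have := dN N (leqnn _); rewrite sub0r normrN; apply: le_lt_trans.
exact: ler_norm.
Qed.

Lemma geometric_cvg (R : realType) (H : completeNormedModType R[i])
    (u : nat -> H) (C r : R) : 0 <= C -> 0 <= r < 1 ->
    (forall n, rnorm (u n.+1 - u n) <= C * r ^+ n) ->
  exists l : H, u @ \oo --> l.
Proof.
move=> C0 /andP[r0 r1] ur.
pose d n := C / (1 - r) * r ^+ n.
have r10 : 0 < 1 - r by rewrite subr_gt0.
apply: (@rnorm_dominated_cvg _ _ _ d).
  rewrite -[X in _ --> X](mulr0 (C / (1 - r))).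
  by apply: cvgM; [exact: cvg_cst|apply: cvg_expr; rewrite ger0_norm].
(* the factor 1 - r^k is what an induction on k preserves *)
suff uk m k : rnorm (u (m + k)%N - u m) <= C / (1 - r) * (r ^+ m * (1 - r ^+ k)).
  move=> m k; apply: le_trans (uk m k) _.
  rewrite /d ler_wpM2l ?divr_ge0 ?(ltW r10)// ler_piMr ?exprn_ge0// gerBl.
  exact: exprn_ge0.
elim: k => [|k IH]; first by rewrite addn0 subrr rnorm0 expr0 subrr !mulr0.
rewrite addnS -(subrKA (u (m + k)%N)).
apply: le_trans (ler_rnormD _ _) _; apply: le_trans (lerD (ur _) IH) _.
rewrite exprD exprS le_eqVlt; apply/orP; left; apply/eqP.
by field; rewrite gt_eqF.
Qed.

Lemma rnorm_lim_le (R : realType) (H : normedModType R[i])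
    (u : nat -> H) (l : H) (c : R) :
  u @ \oo --> l -> (forall n, rnorm (u n) <= c) -> rnorm l <= c.
Proof.
move=> /cvg_rnorm ul uc.
suff : rnorm l - c <= 0 by rewrite subr_le0.
apply: (ler_cvg_to (f := fun=> rnorm l - c) _ ul); first exact: cvg_cst.
near=> n; have := uc n; have := ler_rnormD (u n) (l - u n).
by rewrite addrC subrK (rnormB l); lra.
Unshelve. all: by end_near. Qed.

(** Numbering [I] by [pickle] leaves gaps in [nat], at which [pickle_inv] is
    [None] and the summand is 0. *)
Lemma esum_countable (R : realType) (I : countType) (f : I -> \bar R) :
    (forall i, (0 <= f i)%E) ->
  \esum_(i in [set: I]) f i =
    (\sum_(n <oo) oapp f 0%E (pickle_inv n))%E.
Proof.
move=> f0; rewrite nneseries_esumT; last by move=> n; case: pickle_inv.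
transitivity (\esum_(n in pickle @` [set: I]) oapp f 0%E (pickle_inv n)).
  rewrite esum_image; last by move=> i j _ _; exact: (pcan_inj pickleK).
  by apply: eq_esum => i _; rewrite pickleK_inv.
rewrite esum_mkcond; apply: eq_esum => n _.
case: ifPn => //; rewrite notin_setE => nP.
case E : (pickle_inv n) => [i|] //=; exfalso; apply: nP.
by exists i => //; have := @pickle_invK I n; rewrite /ocancel E.
Qed.

End convergence.

(** * Inner product and self-adjoint maps *)

Section hilbert.
Local Open Scope classical_set_scope.
Context (R : realType) (H : completeNormedModType R[i]).
Context (dot : {dot H for conjC}) (dotH : hilbert_dot dot).
Implicit Types (u v w : H) (S T X Y Z : H -> H).

Lemma dotvv v : dot v v = (rnorm v ^+ 2)%:C.
Proof. by rewrite -dotH normr_rnorm rmorphXn. Qed.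

Lemma dotC u v : dot u v = conjC (dot v u).
Proof. by rewrite hermC expr0 mul1r. Qed.

Lemma dot_inj u v : (forall w, dot u w = dot v w) -> u = v.
Proof.
move=> uv; apply/eqP; rewrite -subr_eq0; apply/eqP/rnorm0_eq0.
have : dot (u - v) (u - v) = 0 by rewrite linearBl /= uv subrr.
by rewrite dotvv => /complexI/eqP; rewrite expf_eq0 /= => /eqP.
Qed.

(** The Cauchy-Schwarz inequality: [u] is the sum of [a *: v] and of a vector
    orthogonal to [v]. *)
Lemma rnorm_dot_le u v : rnorm (dot u v) <= rnorm u * rnorm v.
Proof.
have [->|v0] := eqVneq v 0; first by rewrite linear0r !rnorm0 mulr0.
have vv0 : dot v v != 0 by rewrite dnorm_eq0.
pose a := dot u v / dot v v; pose w := u - a *: v.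
have wv : dot w v = 0 by rewrite linearBl linearZl_LR /= divfK// subrr.
have uE : u = w + a *: v by rewrite subrK.
have : rnorm u ^+ 2 = rnorm w ^+ 2 + (rnorm a * rnorm v) ^+ 2.
  apply: complexI; rewrite rmorphD /= -rnormZ -!dotvv {1 2}uE hnormDd//.
  by rewrite linearZr_LR /= wv mulr0.
have uvE : dot u v = a * dot v v by rewrite divfK.
rewrite {}uvE {uE wv}; move: a w => a w u2.
rewrite rnormM dotvv rnorm_real ger0_norm ?sqr_ge0// expr2 mulrA.
rewrite ler_wpM2r ?rnorm_ge0// -ler_sqr ?nnegrE ?mulr_ge0 ?rnorm_ge0//.
by rewrite u2 lerDr sqr_ge0.
Qed.

Lemma cvg_dotl (u : nat -> H) (l w : H) :
  u @ \oo --> l -> dot (u n) w @[n --> \oo] --> dot l w.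
Proof.
move=> /cvg_rnorm ul; apply/(@cvg_rnorm _ R[i]^o).
apply: (@squeeze_cvgr _ _ _ _ (fun=> 0) (fun n => rnorm (u n - l) * rnorm w)).
- by near=> n; rewrite rnorm_ge0 -linearBl rnorm_dot_le.
- exact: cvg_cst.
- by rewrite -[X in _ --> X](mul0r (rnorm w)); apply: cvgM => //; exact: cvg_cst.
Unshelve. all: by end_near. Qed.

Lemma cvg_dotr (u : nat -> H) (l w : H) :
  u @ \oo --> l -> dot w (u n) @[n --> \oo] --> dot w l.
Proof.
move=> /cvg_rnorm ul; apply/(@cvg_rnorm _ R[i]^o).
apply: (@squeeze_cvgr _ _ _ _ (fun=> 0) (fun n => rnorm w * rnorm (u n - l))).
- by near=> n; rewrite rnorm_ge0 -linearBr rnorm_dot_le.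
- exact: cvg_cst.
- by rewrite -[X in _ --> X](mulr0 (rnorm w)); apply: cvgM => //; exact: cvg_cst.
Unshelve. all: by end_near. Qed.

(** The real inner product underlying [dot]; quadratic forms of self-adjoint
    maps are read through it. *)
Definition rdot u v : R := complex.Re (dot u v).

Lemma rdotvv v : rdot v v = rnorm v ^+ 2.
Proof. by rewrite /rdot dotvv. Qed.

Lemma rdotC u v : rdot u v = rdot v u.
Proof. by rewrite /rdot dotC; case: (dot v u). Qed.

Lemma rdotDl u v w : rdot (u + v) w = rdot u w + rdot v w.
Proof. by rewrite /rdot linearDl raddfD. Qed.

Lemma rdotBl u v w : rdot (u - v) w = rdot u w - rdot v w.
Proof. by rewrite /rdot linearBl raddfB. Qed.

Lemma rdotDr u v w : rdot u (v + w) = rdot u v + rdot u w.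
Proof. by rewrite /rdot linearDr raddfD. Qed.

Lemma rdotBr u v w : rdot u (v - w) = rdot u v - rdot u w.
Proof. by rewrite /rdot linearBr raddfB. Qed.

Lemma rdotZl a u v : rdot (a%:C *: u) v = a * rdot u v.
Proof.
by rewrite /rdot linearZl_LR /=; case: (dot u v) => x y /=; rewrite mul0r subr0.
Qed.

Lemma rdot_le u v : `|rdot u v| <= rnorm u * rnorm v.
Proof. by apply: le_trans (rnorm_dot_le u v); rewrite -lecR -normr_rnorm normc_ge_Re. Qed.

Lemma cvg_rdotl (u : nat -> H) (l w : H) :
  u @ \oo --> l -> rdot (u n) w @[n --> \oo] --> rdot l w.
Proof.
move=> /cvg_rnorm ul; apply/subr_cvg0/norm_cvg0P.
apply: (@squeeze_cvgr _ _ _ _ (fun=> 0) (fun n => rnorm (u n - l) * rnorm w)).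
- by near=> n; rewrite normr_ge0 -rdotBl rdot_le.
- exact: cvg_cst.
- by rewrite -[X in _ --> X](mul0r (rnorm w)); apply: cvgM => //; exact: cvg_cst.
Unshelve. all: by end_near. Qed.

(** An everywhere defined map with this property is automatically linear, so
    bare functions suffice as operators. *)
Definition selfadjoint T := forall u v, dot (T u) v = dot u (T v).

Lemma selfadjoint_lim (Tn : nat -> H -> H) T :
  (forall n, selfadjoint (Tn n)) -> (forall v, Tn ^~ v @ \oo --> T v) ->
  selfadjoint T.
Proof.
move=> saTn TnT u v.
apply: (@cvg_unique _ _ (dot (Tn n u) v @[n --> \oo])) => //.
  exact: cvg_dotl.
have -> : (fun n => dot (Tn n u) v) = (fun n => dot u (Tn n v)).
  by apply/funext => n; exact: saTn.
exact: cvg_dotr.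
Qed.

Definition bounded_by (r : R) T := forall v, rnorm (T v) <= r * rnorm v.

Section selfadjoint_linear.
Context T (saT : selfadjoint T).

Lemma selfadjointD u v : T (u + v) = T u + T v.
Proof. by apply: dot_inj => w; rewrite saT !linearDl /= !saT. Qed.

Lemma selfadjointB u v : T (u - v) = T u - T v.
Proof. by apply: dot_inj => w; rewrite saT !linearBl /= !saT. Qed.

Lemma selfadjointZ a v : T (a *: v) = a *: T v.
Proof. by apply: dot_inj => w; rewrite saT !linearZl_LR /= saT. Qed.

Lemma selfadjoint0 : T 0 = 0.
Proof. by rewrite -[in LHS](subrr (0 : H)) selfadjointB subrr. Qed.

Lemma bounded_cvg (C : R) (u : nat -> H) (l : H) :
  bounded_by C T -> u @ \oo --> l -> T (u n) @[n --> \oo] --> T l.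
Proof.
move=> TC /cvg_rnorm ul; apply/cvg_rnorm.
apply: (@squeeze_cvgr _ _ _ _ (fun=> 0) (fun n => C * rnorm (u n - l))).
- by near=> n; rewrite rnorm_ge0 -selfadjointB TC.
- exact: cvg_cst.
- by rewrite -[X in _ --> X](mulr0 C); apply: cvgM => //; exact: cvg_cst.
Unshelve. all: by end_near. Qed.

(** For self-adjoint [T], polarization gives
    4 Re <T v, w> = <T (v + w), v + w> - <T (v - w), v - w>;
    by the parallelogram law this is at most 2 q (|v|^2 + |w|^2), and [w = q^-1 *: T v] yields the bound on |T v|. *)
Lemma numerical_radius_bound (q : R) : 0 < q ->
  (forall v, `|rdot (T v) v| <= q * rnorm v ^+ 2) -> bounded_by q T.
Proof.
move=> q0 Tq v; set t := rnorm (T v).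
rewrite -ler_sqr ?nnegrE ?mulr_ge0 ?rnorm_ge0 ?(ltW q0)//.
pose w := (q^-1)%:C *: T v.
have := Tq (v + w); have := Tq (v - w); rewrite !ler_norml.
move=> /andP[lo _] /andP[_ up].
have Tw : rdot (T w) v = q^-1 * t ^+ 2.
  by rewrite /rdot saT -/(rdot _ _) rdotZl rdotvv.
have Tv : rdot (T v) w = q^-1 * t ^+ 2 by rewrite rdotC rdotZl rdotvv.
have ww : rdot w w = q^-1 ^+ 2 * t ^+ 2.
  by rewrite rdotZl rdotC rdotZl rdotvv mulrA -expr2.
rewrite -!rdotvv selfadjointB selfadjointD in lo up.
rewrite !rdotBl !rdotBr Tw Tv ww (rdotC w v) rdotvv in lo.
rewrite !rdotDl !rdotDr Tw Tv ww (rdotC w v) rdotvv in up.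
have le4 : 4 * (q^-1 * t ^+ 2) <= 2 * q * (rnorm v ^+ 2 + q^-1 ^+ 2 * t ^+ 2).
  by lra.
have q0' : q != 0 by rewrite gt_eqF.
have := ler_wpM2l (ltW q0) le4.
have -> : q * (4 * (q^-1 * t ^+ 2)) = 4 * t ^+ 2 by field.
have -> : q * (2 * q * (rnorm v ^+ 2 + q^-1 ^+ 2 * t ^+ 2)) =
  2 * (q * rnorm v) ^+ 2 + 2 * t ^+ 2 by field.
lra.
Qed.

End selfadjoint_linear.

(** * The frame operator *)

(** The operator S v = sum_i <v, x_i> x_i. For a block d of this series,
    |d|^2 = sum <v, x_i> <x_i, d>, which the inequality of arithmetic and
    geometric means bounds by (B sum |<v, x_i>|^2 + B^-1 sum |<d, x_i>|^2) / 2.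
    The upper frame bound at d makes the last term at most |d|^2 / 2, so |d|^2
    is at most B times a block of a convergent real series. *)
Lemma frame_operator (I : countType) (x_ : I -> H) (B : R) : 0 < B ->
    (forall v, (\esum_(i in [set: I]) (sqnorm (dot v (x_ i)))%:E <=
                (B * rnorm v ^+ 2)%:E)%E) ->
  exists2 S, selfadjoint S &
    forall v, \esum_(i in [set: I]) (sqnorm (dot v (x_ i)))%:E =
              (rdot (S v) v)%:E.
Proof.
move=> B0 bessel.
pose f n : H := oapp x_ 0 (pickle_inv n).
have esumE v : \esum_(i in [set: I]) (sqnorm (dot v (x_ i)))%:E =
    (\sum_(n <oo) (sqnorm (dot v (f n)))%:E)%E.
  rewrite esum_countable => [|i]; last by rewrite lee_fin sqnormE sqr_ge0.
  apply: eq_eseriesr => n _; rewrite /f; case: pickle_inv => //=.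
  by rewrite linear0r sqnormE rnorm0 expr0n.
pose s v : nat -> R := series (fun n => sqnorm (dot v (f n))).
have sq0 v n : 0 <= sqnorm (dot v (f n)) by rewrite sqnormE sqr_ge0.
have s_nd v : nondecreasing_seq (s v).
  by apply/nondecreasing_seqP => n; rewrite /s seriesSr lerDl.
have s_le v n : s v n <= B * rnorm v ^+ 2.
  rewrite -lee_fin; apply: le_trans (bessel v); rewrite esumE.
  rewrite /s /series /= -sumEFin.
  by apply: nneseries_lim_ge => k _ _; rewrite lee_fin.
have s_cvg v : cvgn (s v).
  apply: nondecreasing_is_cvgn => //.
  by exists (B * rnorm v ^+ 2) => _ [n _ <-].
pose Sn n v : H := \sum_(0 <= k < n) dot v (f k) *: f k.
have dotSn n u v : dot (Sn n u) v = \sum_(0 <= k < n) dot u (f k) * dot (f k) v.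
  by rewrite linear_sumlz; apply: eq_bigr => k _; rewrite linearZl_LR.
have saSn n : selfadjoint (Sn n).
    move=> u v; rewrite dotSn dotC dotSn rmorph_sum; apply: eq_bigr => k _.
  by rewrite rmorphM /= -!dotC mulrC.
have rdotSn n v : rdot (Sn n v) v = s v n.
  rewrite /rdot dotSn raddf_sum /=; apply: eq_bigr => k _.
  rewrite (dotC (f k)) -normCK sqnormE normr_rnorm -rmorphXn /=.
  by [].
have SnB m k v : rnorm (Sn (m + k)%N v - Sn m v) ^+ 2 <= B * (s v (m + k)%N - s v m).
  set d := _ - _.
  have dE : d = \sum_(m <= j < m + k) dot v (f j) *: f j.
    by rewrite /d /Sn (big_cat_nat _ (leq_addr k m))//= addrAC subrr add0r.
  have sE w : s w (m + k)%N - s w m = \sum_(m <= j < m + k) sqnorm (dot w (f j)).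
    by rewrite /s /series /= (big_cat_nat _ (leq_addr k m))//= addrAC subrr add0r.
  have d2 : rnorm d ^+ 2 <=
      \sum_(m <= j < m + k) (B * sqnorm (dot v (f j)) + B^-1 * sqnorm (dot d (f j))) / 2.
    rewrite -rdotvv {1}dE /rdot linear_sumlz raddf_sum /=; apply: ler_sum => j _.
    rewrite linearZl_LR /=.
    have -> : complex.Re (dot v (f j) * dot (f j) d) =
        complex.Re (dot v (f j) * conjC (dot d (f j))) by rewrite -dotC.
    apply: le_trans (ler_norm _) _.
    have := normc_ge_Re (dot v (f j) * conjC (dot d (f j))).
    rewrite normr_rnorm lecR rnormM rnorm_conj => /le_trans; apply.
    rewrite !sqnormE; set a := rnorm (dot v _); set b := rnorm (dot d _).
    have -> : (B * a ^+ 2 + B^-1 * b ^+ 2) / 2 = a * b + B^-1 * (B * a - b) ^+ 2 / 2.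
      by field; rewrite gt_eqF.
    by rewrite lerDl divr_ge0// mulr_ge0 ?sqr_ge0// invr_ge0 ltW.
  have sd : s d (m + k)%N - s d m <= B * rnorm d ^+ 2.
    have s0 : 0 <= s d m by apply: sumr_ge0.
    by have := s_le d (m + k)%N; lra.
  rewrite -mulr_suml big_split /= -!mulr_sumr -!sE in d2.
  have := ler_wpM2l (ltW (_ : 0 < B^-1)) sd; rewrite invr_gt0 => /(_ B0).
  rewrite mulKf ?gt_eqF// => sd'; lra.
have SnC v : exists l : H, Sn ^~ v @ \oo --> l.
  apply: (@rnorm_dominated_cvg _ _ _ (fun m => Num.sqrt (B * (limn (s v) - s v m)))).
    rewrite -[X in _ --> X]sqrtr0; apply: continuous_cvg; first exact: sqrt_continuous.
    rewrite -(mulr0 B) -(subrr (limn (s v))).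
    by apply: cvgM; [exact: cvg_cst|apply: cvgB => //; exact: cvg_cst].
  move=> m k; rewrite -(ger0_norm (rnorm_ge0 _)) -sqrtr_sqr ler_sqrt.
    apply: le_trans (SnB _ _ _) _; rewrite ler_wpM2l ?(ltW B0)// lerD2r.
    exact: nondecreasing_cvgn_le.
  by rewrite mulr_ge0 ?(ltW B0)// subr_ge0 nondecreasing_cvgn_le.
have [S SnS] := choice SnC.
exists S => [|v]; first exact: selfadjoint_lim SnS.
have sS : s v @ \oo --> rdot (S v) v.
  have -> : s v = fun n => rdot (Sn n v) v by apply/funext => n; rewrite rdotSn.
  exact: cvg_rdotl.
rewrite esumE; apply: cvg_lim => //; under eq_fun do rewrite sumEFin.
by apply: cvg_EFin; [exact: nearW|exact: sS].
Qed.

(** * Functional calculus by iteration *)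

(** For each [v], the affine contraction [x |-> v + T x] has the fixed point
    [D v]; self-adjointness of [D] then follows from that of its inverse. *)
Lemma neumann_inverse T (r : R) :
    0 <= r < 1 -> selfadjoint T -> bounded_by r T ->
  exists D, [/\ selfadjoint D, forall v, D v - T (D v) = v &
                forall v, D (v - T v) = v].
Proof.
move=> /andP[r0 r1] saT Tr.
pose u w := fix u n := if n is n'.+1 then w + T (u n') else 0.
have uC w : exists l : H, u w @ \oo --> l.
  apply: (@geometric_cvg _ _ _ (rnorm w) r); rewrite ?rnorm_ge0 ?r0//.
  elim=> [|n IH]; first by rewrite /= (selfadjoint0 saT) addr0 subr0 expr0 mulr1.
  have -> : u w n.+2 - u w n.+1 = T (u w n.+1 - u w n).
    by rewrite (selfadjointB saT) /= opprD addrACA subrr add0r.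
  by rewrite exprS mulrCA; apply: le_trans (Tr _) _; rewrite ler_wpM2l.
have [D uD] := choice uC.
have DT v : D v - T (D v) = v.
  apply/eqP; rewrite subr_eq; apply/eqP.
  have Tu : T (u v n) @[n --> \oo] --> T (D v) by exact: bounded_cvg (uD v).
  apply: (@cvg_unique _ _ (u v n.+1 @[n --> \oo])) => //.
    by have := uD v; rewrite -cvg_shiftS.
  by apply: cvgD => //; exact: cvg_cst.
have Tinj v : v - T v = 0 -> v = 0.
  move=> /eqP; rewrite subr_eq0 => /eqP vT; apply: rnorm0_eq0.
  by have := Tr v; rewrite -vT; have := rnorm_ge0 v; nra.
have TD v : D (v - T v) = v.
  apply/eqP; rewrite -subr_eq0; apply/eqP/Tinj.
  by rewrite (selfadjointB saT) opprD addrACA -opprD DT subrr.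
exists D; split=> // u' v.
rewrite -{2}(DT u') -{1}(DT v) linearBl linearBr /=.
by rewrite saT.
Qed.

(** The map [Z] is 1 - sqrt(1 - Y): the identity 2 Z = Y + Z^2 says that
    (1 - Z)^2 = 1 - Y. It is the limit of the iteration
    Z_(n+1) = (Y + Z_n^2) / 2 started at 0, which contracts by the factor [r] on
    the ball of radius [r]. Each Z_n is a polynomial in [Y], whence the last
    clause. *)
Lemma one_minus_sqrt Y (r : R) :
    0 <= r < 1 -> selfadjoint Y -> bounded_by r Y ->
  exists Z, [/\ selfadjoint Z, bounded_by r Z,
     forall v, Z v + Z v = Y v + Z (Z v) &
     forall X (C : R), selfadjoint X -> bounded_by C X ->
       (forall v, X (Y v) = Y (X v)) -> forall v, X (Z v) = Z (X v)].
Proof.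
move=> /andP[r0 r1] saY Yr.
pose h : R[i] := (2^-1)%:C.
pose Zn := fix Zn n v : H :=
  if n is n'.+1 then h *: (Y v + Zn n' (Zn n' v)) else 0.
have hh v : h *: v + h *: v = v.
  rewrite -scalerDl -rmorphD /=.
  have -> : 2^-1 + 2^-1 = 1 :> R by field.
  by rewrite rmorph1 scale1r.
have rnormh v : rnorm (h *: v) = 2^-1 * rnorm v by rewrite rnormZ rnorm_real ger0_norm.
have hconj : conjC h = h by exact: conj_real.
have saZ n : selfadjoint (Zn n).
  elim: n => [|n IH] u v /=; first by rewrite linear0l linear0r.
  rewrite linearZl_LR linearZr_LR /= hconj !(linearDl, linearDr) /=.
  by rewrite saY !IH.
have Zr n : bounded_by r (Zn n).
  elim: n => [|n IH] v /=; first by rewrite rnorm0 mulr_ge0 ?rnorm_ge0.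
  rewrite rnormh; have := ler_rnormD (Y v) (Zn n (Zn n v)).
  have := Yr v; have := IH (Zn n v); have := IH v.
  move: (rnorm_ge0 v) (rnorm_ge0 (Zn n v)); nra.
have ZB n v : rnorm (Zn n.+1 v - Zn n v) <= r * rnorm v * r ^+ n.
  elim: n v => [|n IH] v.
    rewrite /= subr0 addr0 rnormh expr0; have := Yr v; move: (rnorm_ge0 v); nra.
  (* a noncommutative difference of squares: 2 (Z_(n+2) - Z_(n+1)) is
     Z_(n+1) (Z_(n+1) - Z_n) + (Z_(n+1) - Z_n) Z_n *)
  have -> : Zn n.+2 v - Zn n.+1 v =
      h *: (Zn n.+1 (Zn n.+1 v - Zn n v) +
            (Zn n.+1 (Zn n v) - Zn n (Zn n v))).
    rewrite (selfadjointB (saZ _)) subrKA.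
    by rewrite [in LHS]/= -scalerBr opprD addrACA subrr add0r.
  rewrite rnormh; set a := Zn n.+1 (_ - _); set b := Zn n.+1 _ - _.
  have := ler_rnormD a b.
  have la : rnorm a <= r * (r * rnorm v * r ^+ n).
    by apply: le_trans (Zr _ _) _; rewrite ler_wpM2l.
  have lb : rnorm b <= r * (r * rnorm v) * r ^+ n.
    apply: le_trans (IH _) _; rewrite ler_wpM2r ?exprn_ge0// ler_wpM2l//.
    exact: Zr.
  rewrite exprS => lab; lra.
have ZC v : exists l : H, Zn ^~ v @ \oo --> l.
  apply: (@geometric_cvg _ _ _ (r * rnorm v) r) => [||n]; last exact: ZB.
    by rewrite mulr_ge0 ?rnorm_ge0.
  by rewrite r0.
have [Z ZZ] := choice ZC.
have saZZ : selfadjoint Z by exact: selfadjoint_lim ZZ.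
exists Z; split=> //.
- by move=> v; apply: rnorm_lim_le (ZZ v) _ => n; exact: Zr.
- move=> v.
  have Z2 : Zn n (Zn n v) @[n --> \oo] --> Z (Z v).
    apply/cvg_rnorm.
    apply: (@squeeze_cvgr _ _ _ _ (fun=> 0)
       (fun n => r * rnorm (Zn n v - Z v) + rnorm (Zn n (Z v) - Z (Z v)))).
    + near=> n; rewrite rnorm_ge0/= -(subrKA (Zn n (Z v))).
      apply: le_trans (ler_rnormD _ _) _.
      by rewrite -(selfadjointB (saZ n)) lerD2r Zr.
    + exact: cvg_cst.
    + have /cvg_rnorm Z1 := ZZ v; have /cvg_rnorm Z1' := ZZ (Z v).
      rewrite (_ : 0 = r * 0 + 0); last by rewrite mulr0 addr0.
      by apply: (cvgD _ Z1'); apply: cvgM => //; exact: cvg_cst.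
  suff ZE : Z v = h *: (Y v + Z (Z v)) by rewrite -[RHS]hh -ZE.
  apply: (@cvg_unique _ _ (Zn n.+1 v @[n --> \oo])) => //.
    by have := ZZ v; rewrite -cvg_shiftS.
  by apply: cvgZr; apply: cvgD => //; exact: cvg_cst.
- move=> X C saX XC XY v.
  have XZ n u : X (Zn n u) = Zn n (X u).
    elim: n u => [|n IH] u /=; first exact: selfadjoint0.
    by rewrite (selfadjointZ saX) (selfadjointD saX) XY !IH.
  apply: (@cvg_unique _ _ (X (Zn n v) @[n --> \oo])) => //.
    exact: bounded_cvg (ZZ v).
  have -> : (fun n => X (Zn n v)) = Zn ^~ (X v) by apply/funext => n; exact: XZ.
  exact: ZZ.
Unshelve. all: by end_near. Qed.

(** The map K = sqrt((1 + X) / (1 - X)), obtained as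
    (1 + X) (1 - X^2)^(-1/2) so that one square root and one inverse suffice:
    with 1 - Z the square root of 1 - X^2 and D its inverse, K = D (1 + X), and
    (1 + X) (1 - X) = (1 - Z)^2 cancels both factors D. *)
Lemma sqrt_cayley X (q : R) :
    0 <= q < 1 -> selfadjoint X -> bounded_by q X ->
  exists K, [/\ selfadjoint K, forall v, K (X v) = X (K v) &
    forall v, K (K (v - X v)) = v + X v].
Proof.
move=> /andP[q0 q1] saX Xq.
pose Y v := X (X v).
have saY : selfadjoint Y by move=> u v; rewrite /Y !saX.
have Yq : bounded_by (q * q) Y.
  by move=> v; apply: le_trans (Xq _) _; rewrite -mulrA ler_wpM2l.
have qq : 0 <= q * q < 1 by apply/andP; split; nra.
have [Z [saZ Zq ZE Zcomm]] := one_minus_sqrt qq saY Yq.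
have XZ := Zcomm X q saX Xq (fun=> erefl).
have [D [saD QD DQ]] := neumann_inverse qq saZ Zq.
have DX v : D (X v) = X (D v).
  by rewrite -{1}(QD v) (selfadjointB saX) XZ DQ.
exists (fun v => D (v + X v)); split=> [u v|v|v].
- by rewrite saD (selfadjointD saD) linearDl linearDr /= DX saX.
- by rewrite -(selfadjointD saX) DX.
- have -> : v - X v + X (v - X v) = (v - Z v) - Z (v - Z v).
    rewrite (selfadjointB saX) (selfadjointB saZ) subrKA.
    rewrite -[X (X v)]/(Y v) -(addrK (Z (Z v)) (Y v)) -ZE.
    by rewrite -[Z v + Z v - _]addrA opprD addrA.
  by rewrite DQ (selfadjointB saX) XZ addrACA -opprD -(selfadjointD saZ) DQ.
Qed.

(** * The decomposition *)

(** Both scalars e = i and e = -i are covered. With V = c (1 + e K), the adjoint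
    of V is c (1 - e K), so the sum of |<v, V x_i>|^2 is the quadratic form of
    V S V^* = c^2 (S + K^2 S): the cross terms e (K S - S K) vanish and
    e times its conjugate is 1. *)
Lemma half_tight_frame S K (t c : R) (e : R[i]) (I : countType) (x_ : I -> H) :
    selfadjoint S -> selfadjoint K -> (forall v, K (S v) = S (K v)) ->
    (forall v, S v + K (K (S v)) = (2 * t)%:C *: v) ->
    c ^+ 2 * (2 * t) = 1 -> conjC e = - e -> e * e = -1 ->
    (forall v, \esum_(i in [set: I]) (sqnorm (dot v (x_ i)))%:E =
               (rdot (S v) v)%:E) ->
  is_normalized_tight_frame dot (fun i => c%:C *: (x_ i + e *: K (x_ i))).
Proof.
move=> saS saK KS SK ct eN ee frS v.
(* the adjoint of V applied to v *)
pose w := c%:C *: (v - e *: K v).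
have wE i : dot v (c%:C *: (x_ i + e *: K (x_ i))) = dot w (x_ i).
  rewrite linearZr_LR linearZl_LR /= linearDr linearBl /= linearZr_LR linearZl_LR.
  by rewrite /= conj_real eN saK mulNr.
under eq_esum do rewrite wE.
rewrite frS; congr (_%:E).
have -> : S w = c%:C *: (S v - e *: S (K v)).
  by rewrite (selfadjointZ saS) (selfadjointB saS) (selfadjointZ saS).
rewrite sqnormE -rdotvv rdotZl rdotC rdotZl rdotC mulrA -expr2.
suff -> : rdot (S v - e *: S (K v)) (v - e *: K v) = 2 * t * rdot v v.
  by rewrite mulrA ct mul1r.
rewrite -rdotZl -SK /rdot; congr complex.Re.
rewrite linearBl !linearBr linearDl /= !linearZl_LR !linearZr_LR /= eN.
have -> : dot (S v) (K v) = dot (S (K v)) v by rewrite -saK KS.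
have -> : dot (S (K v)) (K v) = dot (K (K (S v))) v by rewrite -KS -saK.
rewrite -[- e *: _]/(- e * _).
have -> : - e * (e * dot (K (K (S v))) v) = dot (K (K (S v))) v.
  by rewrite mulrA mulNr ee opprK mul1r.
by rewrite mulNr !opprK; ring.
Qed.

End hilbert.

Theorem proposition2p7 (R : realType) (H : completeNormedModType R[i])
    (dot : {dot H for conjC}) (dotH : hilbert_dot dot)
    (I : countType) (x_ : I -> H) (x_frame : is_frame dot x_) :
  exists (a : R[i]) (y_ z_ : I -> H),
    [/\ is_normalized_tight_frame dot y_,
        is_normalized_tight_frame dot z_ &
        forall i : I, x_ i = a *: (y_ i + z_ i)].
Proof.
have [A [B [A0 AB frAB]]] := x_frame.
have B0 : 0 < B by exact: lt_le_trans AB.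
have [|S saS frS] := @frame_operator _ _ _ dotH _ x_ B B0.
  by move=> v; have /andP[_] := frAB v; rewrite -sqnormE.
(* dividing by A + B makes the numerical range of X the interval
   [1 - q, q], with 0 < q < 1 even when A = B *)
pose t := A + B; pose q := B / t.
have t0 : 0 < t by exact: addr_gt0.
have q0 : 0 < q by exact: divr_gt0.
have q1 : q < 1 by rewrite /q ltr_pdivrMr// mul1r ltrDr.
pose X v := v - (t^-1)%:C *: S v.
have saX : selfadjoint dot X.
  move=> u v; rewrite /X linearBl linearBr /= linearZl_LR linearZr_LR /=.
  by rewrite conj_real saS.
have Xq : bounded_by q X.
  apply: (numerical_radius_bound dotH saX q0) => v.
  rewrite /X rdotBl rdotZl (rdotvv dotH) -sqnormE.
  have /andP[] := frAB v; rewrite frS !lee_fin => lo up.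
  have [lo' up'] : A / t * sqnorm v <= t^-1 * rdot dot (S v) v /\
                   t^-1 * rdot dot (S v) v <= q * sqnorm v.
    by rewrite /q ![_ / t]mulrC -!mulrA !ler_pM2l ?invr_gt0.
  have At : A / t = 1 - q.
    by rewrite /q -[X in _ = X - _](divff (lt0r_neq0 t0)) -mulrBl addrK.
  have sq0 : 0 <= (1 - q) * sqnorm v.
    by rewrite mulr_ge0 ?sqnormE ?sqr_ge0// subr_ge0 ltW.
  rewrite At in lo'.
  by rewrite ler_norml; apply/andP; split; lra.
have q01 : 0 <= q < 1 by rewrite ltW.
have [K [saK KX KK]] := sqrt_cayley dotH q01 saX Xq.
have SX v : S v = t%:C *: (v - X v).
  rewrite /X opprB addrC subrK scalerA -rmorphM /= divff ?gt_eqF//.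
  by rewrite rmorph1 scale1r.
have KS v : K (S v) = S (K v).
  by rewrite !SX (selfadjointZ dotH saK) (selfadjointB dotH saK) KX.
have SK v : S v + K (K (S v)) = (2 * t)%:C *: v.
  rewrite SX !(selfadjointZ dotH saK) KK -scalerDr addrACA addNr addr0.
  by rewrite -mulr2n -scaler_nat scalerA mulrC rmorphM rmorph_nat.
(* S + K^2 S = 2 t, and the factor c^2 normalizes this to the identity *)
pose c := Num.sqrt (2 * t)^-1.
have tt0 : 0 < 2 * t by rewrite mulr_gt0.
have c0 : 0 < c by rewrite sqrtr_gt0 invr_gt0.
have ct : c ^+ 2 * (2 * t) = 1.
  by rewrite sqr_sqrtr ?invr_ge0 ?ltW// mulVf ?gt_eqF.
have ii : 'i%R * 'i%R = -1 :> R[i] by rewrite -expr2 sqrCi.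
have iN : conjC 'i%R = - 'i%R :> R[i] by exact: conjCi.
exists ((2 * c)^-1)%:C, (fun i => c%:C *: (x_ i + 'i%R *: K (x_ i))),
  (fun i => c%:C *: (x_ i + (- 'i%R) *: K (x_ i))); split.
- exact: (half_tight_frame dotH saS saK KS SK ct iN ii frS).
- apply: (half_tight_frame dotH saS saK KS SK ct _ _ frS).
    by rewrite rmorphN /= iN.
  by rewrite mulrNN.
- move=> i; rewrite -scalerDr scaleNr addrACA subrr addr0 -mulr2n.
  rewrite -(scaler_nat 2 (x_ i)) !scalerA -(rmorph_nat (real_complex R)) -!rmorphM /=.
  by rewrite (mulrC c) mulVf ?rmorph1 ?scale1r// gt_eqF// mulr_gt0.
Qed.
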